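(* Let $G$ be a simple graph of order $n$, with $m$ edges, with maximum degree $\Delta$ and minimum degree $\delta$. If $\alpha\in[0,1)$, then $$\rho_\alpha(G)\le\min\left\{\Delta,\ \frac12\bigl(\alpha(\Delta+1)+\delta-1\bigr)+\frac12\sqrt{(\alpha(\Delta+1)-\delta-1)^2+4(1-\alpha)(2m-n\delta)}\right\}.$$ Equality holds if and only if $G$ is regular or $G$ has a component of order $\Delta+1$ in which each vertex is of degree $\delta$ or $\Delta$, and all other components are $\delta$-regular.
   Context: Graphs are finite and simple. For a graph $G$ with adjacency matrix $A(G)$ and diagonal matrix of vertex degrees $D(G)$, and for $\alpha\in[0,1]$, put $A_\alpha(G)=\alpha D(G)+(1-\alpha)A(G)$; $\rho_\alpha(G)$ denotes the largest eigenvalue of $A_\alpha(G)$. The order of a graph is its number of vertices.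
   Formalization: Equality is characterized for the second (square-root) term alone, not for the minimum: for 2K_2+K_1 with α=0, ρ=Δ=1 equals the minimum although the graph is not of the stated form. *)

(* Defs.v *)
From mathcomp Require Import all_boot all_order all_algebra.
From mathcomp Require Import classical_sets reals.
From mathcomp Require Import complex polyrcf.

Set Implicit Arguments.
Unset Strict Implicit.
Unset Printing Implicit Defensive.

Import Order.TTheory GRing.Theory Num.Theory.

Record sgraph (n : nat) := SGraph {
  adj : rel 'I_n;
  adj_sym : symmetric adj;
  adj_irr : irreflexive adj }.

Section GraphParameters.
Variables (n : nat) (G : sgraph n).

Definition edges : {set {set 'I_n}} :=
  [set E : {set 'I_n} | [exists x, exists y, adj G x y && (E == [set x; y])]].

Definition deg (x : 'I_n) : nat := #|[set y : 'I_n | adj G x y]|.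

Definition max_degree : nat := \max_(x : 'I_n) deg x.

(* Every degree is smaller than n, so the neutral element n of this minimum is
   harmless as soon as the graph has a vertex. *)
Definition min_degree : nat := \big[minn/n]_(x : 'I_n) deg x.

Definition is_regular : Prop := exists k : nat, forall x : 'I_n, deg x = k.

(* Connected components are represented by their vertex sets.  All neighbours
   of a vertex lie in its component, so its degree inside the component is its
   degree in G. *)
Definition component (x : 'I_n) : {set 'I_n} :=
  [set y : 'I_n | connect (adj G) x y].

Definition components : {set {set 'I_n}} :=
  [set C : {set 'I_n} | [exists x, C == component x]].

End GraphParameters.

Local Open Scope ring_scope.

Section Spectrum.
Variable R : realType.

(* A supremum keeps this function total; it is a maximum for symmetric matrices
   of positive size, see largest_eigenvalueP below. *)
Definition largest_eigenvalue (n : nat) (A : 'M[R]_n) : R :=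
  sup [set x : R | eigenvalue A x]%classic.

Definition adj_mx (n : nat) (G : sgraph n) : 'M[R]_n :=
  \matrix_(i, j) (adj G i j)%:R.

Definition deg_mx (n : nat) (G : sgraph n) : 'M[R]_n :=
  diag_mx (\row_i (deg G i)%:R).

Definition A_alpha (alpha : R) (n : nat) (G : sgraph n) : 'M[R]_n :=
  alpha *: deg_mx G + (1 - alpha) *: adj_mx G.

Definition rho_alpha (alpha : R) (n : nat) (G : sgraph n) : R :=
  largest_eigenvalue (A_alpha alpha G).

Definition degree_size_bound (alpha : R) (n : nat) (G : sgraph n) : R :=
  let m := #|edges G|%:R in
  let Delta := (max_degree G)%:R in
  let delta := (min_degree G)%:R in
  1 / 2 * (alpha * (Delta + 1) + delta - 1)
  + 1 / 2 * Num.sqrt ((alpha * (Delta + 1) - delta - 1) ^+ 2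
                      + 4 * (1 - alpha) * (2 * m - n%:R * delta)).

Lemma symmetric_eigenvalue_ex (n : nat) (A : 'M[R]_n) :
  (0 < n)%N -> A^T = A -> exists a, eigenvalue A a.
Proof.
move=> n_gt0 symA; pose f := real_complex R.
pose B := map_mx f A.
have [z /eigenvalueP [v vB v0]] : exists z, eigenvalue B z.
  have /closed_rootP [a rAa] : size (char_poly B) != 1%N.
    by rewrite size_char_poly; case: (n) n_gt0.
  by exists a; rewrite eigenvalue_root_char.
pose w := map_mx Num.conj v.
have realB : map_mx Num.conj B = B.
  apply/matrixP => i j; rewrite !mxE; apply/CrealP.
  by apply/complex_realP; exists (A i j).
have wB : w *m B = z^* *: w.
  by rewrite -{1}realB -map_mxM vB; apply/matrixP => i j; rewrite !mxE rmorphM.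
have symB : B^T = B by rewrite /B map_trmx symA.
have E1 : (v *m B *m w^T) = z *: (v *m w^T) by rewrite vB scalemxAl.
have E2 : (v *m B *m w^T) = z^* *: (v *m w^T).
  by rewrite -mulmxA -[B]symB -trmx_mul wB linearZ /= scalemxAr.
have N0 : (v *m w^T) 0 0 != 0.
  rewrite mxE (eq_bigr (fun j => `|v 0 j| ^+ 2)); last first.
    by move=> j _; rewrite !mxE normCK.
  rewrite psumr_eq0 => [|j _]; last by rewrite exprn_ge0.
  apply: contra v0 => /allP vz; apply/eqP/rowP => j; rewrite mxE.
  by have := vz j (mem_index_enum _); rewrite expf_eq0 normr_eq0 /= => /eqP.
have zr : z^* = z.
  apply: (mulIf N0).
  by have := congr1 (fun M : 'M_1 => M 0 0) (etrans (esym E1) E2); rewrite !mxE.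
have /complex_realP [a za] : z \is Num.real by apply/CrealP.
exists a; rewrite -(eigenvalue_map f).
by apply/eigenvalueP; exists v => //; rewrite vB za.
Qed.

Lemma largest_eigenvalueP (n : nat) (A : 'M[R]_n) :
  (0 < n)%N -> A^T = A ->
  eigenvalue A (largest_eigenvalue A) /\
  forall a, eigenvalue A a -> a <= largest_eigenvalue A.
Proof.
move=> n_gt0 symA; have [a0 ea0] := symmetric_eigenvalue_ex n_gt0 symA.
pose r := rootsR (char_poly A).
have er a : eigenvalue A a = (a \in r).
  have := roots_on_rootsR (monic_neq0 (char_poly_monic A)) a.
  by rewrite in_itv /= eigenvalue_root_char => ->.
pose M := \big[Order.max/a0]_(x <- r) x.
have ub a : eigenvalue A a -> a <= M.
  by rewrite er => ar; apply: le_bigmax_seq ar _.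
have eM : eigenvalue A M.
  rewrite /M big_seq; elim/big_ind: _ => // [x y ex ey|x]; last by rewrite er.
  by rewrite /Order.max; case: ifP.
suff -> : largest_eigenvalue A = M by [].
apply/le_anti/andP; split.
  by apply: ge_sup; [exists a0|move=> x /ub].
by apply: ub_le_sup => //; exists M => x /ub.
Qed.

Lemma A_alpha_sym (alpha : R) (n : nat) (G : sgraph n) :
  (A_alpha alpha G)^T = A_alpha alpha G.
Proof.
rewrite /A_alpha linearD !linearZ /= tr_diag_mx; congr (_ + _ *: _).
by apply/matrixP => i j; rewrite !mxE adj_sym.
Qed.

End Spectrum.

(* Main.v *)
Require Import Defs.
From mathcomp Require Import all_boot all_order all_algebra.
From mathcomp Require Import boolp classical_sets reals.
From mathcomp Require Import ring lra.

Set Implicit Arguments.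
Unset Strict Implicit.
Unset Printing Implicit Defensive.

Import Order.TTheory GRing.Theory Num.Theory.
Local Open Scope ring_scope.

(** The proof tests the matrix B = A_alpha against degrees.  Write d for the
    degree vector, 1 for the all-one vector, K = (1 - alpha) (2m - n delta) and
    beta = alpha (Delta + 1) - 1.  Completing the square shows that the radical
    expression of the theorem is the larger root of
    (x - delta) (x - beta) = K ([bound_root]).

    Two facts about B suffice.  First, B 1 = d.  Secondly
    ([A_alpha_fun_degree_excess]),
      B (d - delta 1) = beta (d - delta 1) + K 1 - g,
      g_i = alpha (d_i - delta) (Delta - d_i)
            + (1 - alpha) (sum of d_j - delta over j <> i not adjacent to i),
    where all g_i are nonnegative.  The identity comes from splitting the total
    excess 2m - n delta into the contributions of i, of its neighbours and of
    its non-neighbours.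

    Let x be an eigenvector for rho and z = |x|, so that B z >= rho z.  Since B
    is symmetric, pairing this with 1 and with d - delta 1 gives, for
    Z = z . 1 and W = z . (d - delta 1),
      (rho - delta) Z <= W   and   (rho - beta) W <= K Z - z . g.
    Together they exclude that rho exceeds the larger root
    ([subeigenvalue_le_bound]).  The pairing with 1 also gives rho <= Delta.

    If rho equals the root and G is not regular, then K > 0, rho > beta, and
    both inequalities are equalities ([subeigenvalue_eq_bound]).  Hence
    B z = rho z, so the support of z is a union of components, and g vanishes
    on it.  For a component C in the support this says that the non-neighbours
    of every vertex of C have degree delta.  A vertex of degree other than delta
    is thus adjacent to all other vertices of C, lies in C and has degree
    |C| - 1, which must then be Delta ([extremal_component]).

    Conversely, if g vanishes on a union S of components, then the span of 1
    and d restricted to S is B-invariant and d - s' 1 restricted to S, with s'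
    the smaller root, is an eigenvector for the larger root
    ([bound_eigenvalue]). *)

(** * Degrees, edges and components *)

Section Degrees.
Variables (n : nat) (G : sgraph n).

Lemma deg_le_max x : (deg G x <= max_degree G)%N.
Proof. exact: (leq_bigmax x). Qed.

Lemma min_le_deg x : (min_degree G <= deg G x)%N.
Proof.
rewrite /min_degree; have: x \in index_enum 'I_n by rewrite mem_index_enum.
elim: (index_enum _) => // y s IHs; rewrite big_cons inE geq_min.
by case/predU1P => [<-|/IHs ->]; rewrite ?leqnn ?orbT.
Qed.

Lemma max_degree_ex : (0 < n)%N -> exists x, deg G x = max_degree G.
Proof.
move=> n_gt0; have [|x dx] := @bigop.eq_bigmax _ (deg G); first by rewrite card_ord.
by exists x; rewrite -dx.
Qed.

Lemma min_degree_regular k :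
  (0 < n)%N -> (forall x, deg G x = k) -> min_degree G = k.
Proof.
move=> n_gt0 dk; apply/eqP; rewrite eqn_leq -{1}(dk (Ordinal n_gt0)) min_le_deg.
apply: (big_ind (fun m => k <= m)%N) => [|x y kx ky|x _]; last by rewrite dk.
  rewrite -(dk (Ordinal n_gt0)) (leq_trans (max_card _)) // card_ord //.
by rewrite leq_min kx.
Qed.

(** Bridges the two descriptions of the graph: neighbours y of x correspond to
    the edges {x, y}, so edges can be counted by incidences. *)
Lemma deg_incidence x : deg G x = #|[set E in edges G | x \in E]|.
Proof.
rewrite /deg -(card_in_imset (f := fun y => [set x; y])); last first.
  move=> y z; rewrite !inE => xy xz /setP /(_ y); rewrite !inE eqxx orbT.
  by case/esym/orP => /eqP // yx; rewrite yx adj_irr in xy.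
apply: eq_card => E; rewrite !inE; apply/imsetP/andP.
  move=> [y]; rewrite inE => xy ->; split; last by rewrite !inE eqxx.
  by apply/existsP; exists x; apply/existsP; exists y; rewrite xy eqxx.
move=> [/existsP [u /existsP [v /andP [uv /eqP ->]]]].
rewrite !inE => /orP [] /eqP ->; first by exists v; rewrite ?inE.
by exists u; rewrite ?inE 1?adj_sym // finset.setUC.
Qed.

Lemma handshake : (\sum_x deg G x)%N = (2 * #|edges G|)%N.
Proof.
under eq_bigr => x _ do rewrite deg_incidence -sum1_card.
rewrite (exchange_big_dep (mem (edges G))) /=; last first.
  by move=> x E _; rewrite inE => /andP [].
rewrite mulnC -sum_nat_const; apply: eq_bigr => E Ee; rewrite sum1_card.
have -> : #|[pred x | E \in [set E in edges G | x \in E]]| = #|E|.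
  by apply: eq_card => x; rewrite -[LHS]/(E \in [set E in _ | _]) finset.in_set Ee.
move: Ee; rewrite inE => /existsP [u /existsP [v /andP [uv /eqP ->]]].
by rewrite cards2; case: eqP uv => // ->; rewrite adj_irr.
Qed.

Lemma deg_lt_component x : (deg G x < #|component G x|)%N.
Proof.
rewrite /deg (cardsD1 x (component G x)) inE connect0 add1n ltnS.
apply: subset_leq_card; apply/fintype.subsetP => y; rewrite !inE => xy.
by rewrite connect1 // andbT; apply: contraTneq xy => ->; rewrite adj_irr.
Qed.

(** The neighbourhood of x lies in its component minus x; equal cardinalities
    make the two sets coincide. *)
Lemma adj_of_deg_component x y : #|component G x| = (deg G x).+1 ->
  y \in component G x -> y != x -> adj G x y.
Proof.
move=> cx yC yx.
have sub : [set z | adj G x z] \subset component G x :\ x.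
  apply/fintype.subsetP => z; rewrite !inE => xz.
  by rewrite connect1 // andbT; apply: contraTneq xz => ->; rewrite adj_irr.
have /setP/(_ y) : [set z | adj G x z] = component G x :\ x.
  apply/eqP; rewrite eqEcard sub /=.
  by move: cx; rewrite (cardsD1 x) inE connect0 add1n => -[->].
by rewrite !inE => ->; move: yC; rewrite inE yx => ->.
Qed.

Lemma component_eq x y : y \in component G x -> component G y = component G x.
Proof.
rewrite inE => xy; apply/setP => z; rewrite !inE.
by rewrite (same_connect (sym_connect_sym (adj_sym G)) xy).
Qed.

End Degrees.

(** * The matrix as an operator on functions *)

Section Operator.
Variables (R : realType) (n : nat) (G : sgraph n) (alpha : R).
Hypotheses (alpha_ge0 : 0 <= alpha) (alpha_lt1 : alpha < 1).
Implicit Types (y z : 'I_n -> R) (i j : 'I_n).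

Local Notation d := (fun i => (deg G i)%:R : R).
Local Notation Delta := ((max_degree G)%:R : R).
Local Notation delta := ((min_degree G)%:R : R).
Local Notation beta := (alpha * (Delta + 1) - 1).

Definition A_alpha_fun z i : R :=
  alpha * (deg G i)%:R * z i + (1 - alpha) * \sum_(j | adj G i j) z j.

Lemma eigenvalue_A_alphaP a :
  eigenvalue (A_alpha alpha G) a <->
  exists2 z : 'I_n -> R, exists i, z i != 0 & forall i, A_alpha_fun z i = a * z i.
Proof.
have mulE (v : 'rV[R]_n) i :
    (v *m A_alpha alpha G) 0 i = A_alpha_fun (fun j => v 0 j) i.
  rewrite -[in LHS](A_alpha_sym alpha G) mxE /A_alpha_fun.
  under eq_bigr => j _ do rewrite !mxE mulrDr.
  rewrite big_split /= (bigD1 i) //= eqxx mulr1n big1 ?addr0 => [|j ji].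
    congr (_ + _); first by ring.
    rewrite mulr_sumr [RHS]big_mkcond /=; apply: eq_bigr => j _.
    by case: (adj G i j); rewrite ?mulr0 ?mulr1 /= 1?mulrC.
  by rewrite eq_sym (negPf ji) mulr0n !mulr0.
split=> [/eigenvalueP [v vA v0]|[z [i zi0] zA]].
  exists (fun j => v 0 j); first by apply/rV0Pn.
  by move=> i; rewrite -mulE vA mxE.
apply/eigenvalueP; exists (\row_j z j).
  apply/rowP => j; rewrite mulE !mxE -zA /A_alpha_fun mxE.
  by under eq_bigr => k _ do rewrite mxE.
by apply/rV0Pn; exists i; rewrite mxE.
Qed.

Lemma A_alpha_fun_adjoint y z :
  \sum_i A_alpha_fun y i * z i = \sum_i y i * A_alpha_fun z i.
Proof.
have sumE (f g : 'I_n -> R) : \sum_i A_alpha_fun f i * g i =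
    \sum_i alpha * (deg G i)%:R * f i * g i
    + (1 - alpha) * \sum_i \sum_(j | adj G i j) f j * g i.
  rewrite mulr_sumr -big_split /=; apply: eq_bigr => i _.
  by rewrite -mulr_suml; rewrite /A_alpha_fun; ring.
under [RHS]eq_bigr => i _ do rewrite mulrC.
rewrite !sumE; congr (_ + _ * _).
  by apply: eq_bigr => i _; rewrite -mulrA [y i * _]mulrC mulrA.
rewrite (exchange_big_dep xpredT) //=; apply: eq_bigr => j _.
by apply: eq_big => [i|i _]; rewrite 1?adj_sym // mulrC.
Qed.

Lemma A_alpha_fun1 i : A_alpha_fun (fun=> 1) i = (deg G i)%:R.
Proof.
rewrite /A_alpha_fun /= sumr_const.
have -> : #|adj G i| = deg G i by apply: eq_card => j; rewrite inE.
by ring.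
Qed.

Lemma co_alpha_ge0 : 0 <= 1 - alpha.
Proof. by rewrite subr_ge0 ltW. Qed.

(** The matrix has nonnegative entries, so the triangle inequality turns an
    eigenvector into a nonnegative sub-eigenvector. *)
Lemma A_alpha_fun_norm a z :
  (forall i, A_alpha_fun z i = a * z i) ->
  forall i, a * `|z i| <= A_alpha_fun (fun j => `|z j|) i.
Proof.
move=> zA i; apply: (le_trans (ler_wpM2r (normr_ge0 _) (ler_norm a))).
rewrite -normrM -zA /A_alpha_fun (le_trans (ler_normD _ _)) //.
rewrite !normrM (ger0_norm alpha_ge0) normr_nat.
rewrite (@ger0_norm _ (1 - alpha)) ?co_alpha_ge0 //.
by rewrite lerD2l ler_wpM2l ?co_alpha_ge0 // ler_norm_sum.
Qed.

(** If a nonnegative eigenvector vanishes at a vertex, the eigenvalue equation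
    there is a vanishing sum of nonnegative terms, and since alpha < 1 every
    neighbour is a zero too.  So its support is a union of components. *)
Lemma A_alpha_fun_supp a z :
  (forall i, 0 <= z i) -> (forall i, A_alpha_fun z i = a * z i) ->
  forall i j, connect (adj G) i j -> 0 < z i -> 0 < z j.
Proof.
move=> z_ge0 zA i j; case/connectP => p; elim: p i => [|k p IHp] i /=.
  by move=> _ ->.
move=> /andP [ik kp] jk zi; apply: IHp kp jk _.
rewrite lt0r z_ge0 andbT; apply: contraTneq zi => zk.
have /eqP := zA k; rewrite /A_alpha_fun zk !mulr0 add0r mulf_eq0.
rewrite subr_eq0 gt_eqF //= psumr_eq0 // => /allP /(_ i (mem_index_enum _)).
by rewrite adj_sym ik /= => /eqP ->; rewrite ltxx.
Qed.

(** * The degree identity *)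

(** The amount by which d - delta fails to satisfy the affine eigenvalue
    equation of [A_alpha_fun_degree_excess]. *)
Definition degree_defect i : R :=
  alpha * ((d i - delta) * (Delta - d i))
  + (1 - alpha) * \sum_(j | (j != i) && ~~ adj G i j) (d j - delta).

Definition size_excess : R := (1 - alpha) * (2 * #|edges G|%:R - n%:R * delta).

Lemma degree_excess_ge0 i : 0 <= d i - delta.
Proof. by rewrite subr_ge0 ler_nat min_le_deg. Qed.

Lemma degree_gap_ge0 i : 0 <= Delta - d i.
Proof. by rewrite subr_ge0 ler_nat deg_le_max. Qed.

Lemma degree_defect_ge0 i : 0 <= degree_defect i.
Proof.
rewrite addr_ge0 ?mulr_ge0 ?degree_excess_ge0 ?degree_gap_ge0 ?co_alpha_ge0 //.
by rewrite sumr_ge0 // => j _; apply: degree_excess_ge0.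
Qed.

Lemma sum_degree_excess : \sum_i (d i - delta) = 2 * #|edges G|%:R - n%:R * delta.
Proof.
rewrite sumrB sumr_const card_ord -natr_sum handshake natrM mulr_natl.
by rewrite [_ * delta]mulr_natl.
Qed.

(** The excesses d_j - delta over all vertices sum to 2m - n delta; what the
    neighbours of i contribute is this total minus the excess of i and of its
    non-neighbours.  The diagonal term alpha d_i (d_i - delta) is
    alpha Delta (d_i - delta) minus the first part of the defect, and
    alpha Delta - (1 - alpha) is beta. *)
Lemma A_alpha_fun_degree_excess i :
  A_alpha_fun (fun j => d j - delta) i =
  beta * (d i - delta) + size_excess - degree_defect i.
Proof.
have sumC : \sum_(j | adj G i j) (d j - delta) +
    \sum_(j | (j != i) && ~~ adj G i j) (d j - delta) =
    2 * #|edges G|%:R - n%:R * delta - (d i - delta).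
  rewrite -sum_degree_excess [in RHS](bigD1 i) //=.
  rewrite [X in _ = X - _]addrC addrK [in RHS](bigID (adj G i)) /=; congr (_ + _).
  apply: eq_bigl => j; case: eqP => // ->; by rewrite adj_irr.
rewrite /A_alpha_fun /degree_defect /size_excess.
have -> : \sum_(j | adj G i j) (d j - delta) =
    2 * #|edges G|%:R - n%:R * delta - (d i - delta)
    - \sum_(j | (j != i) && ~~ adj G i j) (d j - delta) by rewrite -sumC addrK.
by ring.
Qed.

Lemma size_excess_ge0 : 0 <= size_excess.
Proof.
rewrite mulr_ge0 ?co_alpha_ge0 // -sum_degree_excess.
by rewrite sumr_ge0 // => i _; apply: degree_excess_ge0.
Qed.

Lemma size_excess_regular : size_excess = 0 -> is_regular G.
Proof.
move=> /eqP; rewrite mulf_eq0 subr_eq0 gt_eqF //= -sum_degree_excess.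
rewrite psumr_eq0 => [/allP d0|i _]; last exact: degree_excess_ge0.
exists (min_degree G) => i; apply/eqP; rewrite -(eqr_nat R) -subr_eq0.
exact: (d0 i (mem_index_enum _)).
Qed.

Local Notation bound := (degree_size_bound alpha G).

(** * The bound as a root of a quadratic *)

(** The radicand is (beta - delta)^2 + 4 K, where K is the excess term. *)
Lemma bound_root :
  (bound - delta) * (bound - beta) = size_excess.
Proof.
rewrite /degree_size_bound; set D := (X in Num.sqrt X).
have D_ge0 : 0 <= D.
  have := size_excess_ge0; rewrite /size_excess => K_ge0.
  by rewrite addr_ge0 ?sqr_ge0 // -mulrA mulr_ge0.
have : Num.sqrt D ^+ 2 = (alpha * (Delta + 1) - delta - 1) ^+ 2 + 4 * size_excess.
  by rewrite sqr_sqrtr // /size_excess mulrA.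
move: (Num.sqrt D) size_excess => s K sE.
have -> : K = (s ^+ 2 - (alpha * (Delta + 1) - delta - 1) ^+ 2) / 4.
  by rewrite sE; field.
by field.
Qed.

(** Selects the larger root: since K >= 0, the square root is at least
    |beta - delta|, so the bound dominates both delta and beta. *)
Lemma bound_ge_shifts :
  delta <= bound /\ beta <= bound.
Proof.
suff : `|alpha * (Delta + 1) - delta - 1| <=
    2 * bound - (alpha * (Delta + 1) + delta - 1).
  by rewrite ler_norml => /andP []; split; lra.
rewrite /degree_size_bound -sqrtr_sqr.
set s := Num.sqrt (_ + _); set t := Num.sqrt _.
have : t <= s.
  rewrite ler_wsqrtr // lerDl -mulrA mulr_ge0 //; exact: size_excess_ge0.
by lra.
Qed.

(** * Sub-eigenvectors and the upper bound *)

Section Upper.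
Variables (a : R) (z : 'I_n -> R).
Hypotheses (z_ge0 : forall i, 0 <= z i) (z_gt0 : exists i, 0 < z i).
Hypothesis sub_eigen : forall i, a * z i <= A_alpha_fun z i.

Lemma sum_gt0 : 0 < \sum_i z i.
Proof.
have [i zi] := z_gt0.
by rewrite (bigD1 i) //= ltr_pwDl ?zi ?sumr_ge0.
Qed.

Lemma sum_A_alpha_fun : \sum_i A_alpha_fun z i = \sum_i z i * d i.
Proof.
under eq_bigr => i _ do rewrite -[A_alpha_fun z i]mulr1.
rewrite (A_alpha_fun_adjoint z (fun=> 1)).
by apply: eq_bigr => i _; rewrite A_alpha_fun1.
Qed.

(** Pairing the sub-eigenvector inequality with the constant 1. *)
Lemma subeigenvalue_le_max_degree : a <= Delta.
Proof.
rewrite -(ler_pM2r sum_gt0) mulr_sumr.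
apply: (@le_trans _ _ (\sum_i A_alpha_fun z i)); first by apply: ler_sum.
rewrite sum_A_alpha_fun mulr_sumr; apply: ler_sum => i _.
by rewrite mulrC ler_wpM2r // ler_nat deg_le_max.
Qed.

Let Z := \sum_i z i.
Let W := \sum_i z i * (d i - delta).

(** The slack in the pairing with 1; it vanishes only if z is a genuine
    eigenvector. *)
Lemma sum_residual : \sum_i (A_alpha_fun z i - a * z i) = W - (a - delta) * Z.
Proof.
rewrite sumrB sum_A_alpha_fun /W -mulr_sumr -/Z.
have -> : \sum_i z i * (d i - delta) = \sum_i z i * d i - delta * Z.
  by rewrite mulr_sumr -sumrB; apply: eq_bigr => i _; ring.
by ring.
Qed.

Lemma le_sum_degree_excess : (a - delta) * Z <= W.
Proof.
by rewrite -subr_ge0 -sum_residual sumr_ge0 // => i _; rewrite subr_ge0.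
Qed.

(** Pairing with d - delta, which is nonnegative, and moving the operator to
    the other side by symmetry. *)
Lemma weighted_sum_degree_excess_le : (a - beta) * W <=
  size_excess * Z - \sum_i z i * degree_defect i.
Proof.
rewrite mulrBl lerBlDl.
have : a * W <= \sum_i A_alpha_fun z i * (d i - delta).
  rewrite mulr_sumr; apply: ler_sum => i _.
  by rewrite mulrA ler_wpM2r ?degree_excess_ge0.
rewrite (A_alpha_fun_adjoint z (fun j => d j - delta)) => /le_trans; apply.
rewrite addrA {}/W {}/Z !mulr_sumr -big_split -sumrB /= le_eqVlt; apply/orP; left.
apply/eqP/eq_bigr => i _; rewrite A_alpha_fun_degree_excess; ring.
Qed.

Lemma sum_defect_ge0 : 0 <= \sum_i z i * degree_defect i.
Proof. by rewrite sumr_ge0 // => i _; rewrite mulr_ge0 ?degree_defect_ge0. Qed.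

(** Above the bound, a - delta and a - beta are both positive.  The pairing with
    1, multiplied by a - beta, combines with the other one to
    (a - delta) (a - beta) <= K, which is false there. *)
Lemma subeigenvalue_le_bound : a <= bound.
Proof.
have [delta_le b_le] := bound_ge_shifts; have r := bound_root.
rewrite leNgt; apply/negP => a_gt.
have h1 := le_sum_degree_excess; have h2 := weighted_sum_degree_excess_le.
have P0 := sum_defect_ge0; have Z0 := sum_gt0; rewrite -/Z in Z0.
have : (a - delta) * (a - beta) <= size_excess.
  rewrite -(ler_pM2r Z0); nra.
rewrite -r leNgt ltr_pM //; lra.
Qed.

(** At the bound all inequalities used above are tight.  The pairing with 1
    enters them multiplied by a - beta, so its tightness needs a <> beta; and
    a = beta would mean K = 0, that is, a regular graph. *)
Lemma subeigenvalue_eq_bound : a = bound -> ~ is_regular G ->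
  (forall i, A_alpha_fun z i = a * z i) /\
  (forall i, 0 < z i -> degree_defect i = 0).
Proof.
move=> aE nreg; have [delta_le b_le] := bound_ge_shifts; have r := bound_root.
rewrite -aE in delta_le b_le r.
have h1 := le_sum_degree_excess; have h2 := weighted_sum_degree_excess_le.
have P0 := sum_defect_ge0; have Z0 := sum_gt0; rewrite -/Z in Z0.
have b_lt : 0 < a - beta.
  rewrite lt0r subr_ge0 b_le andbT; apply/eqP => ab.
  by apply/nreg/size_excess_regular; rewrite -r ab mulr0.
(* The two pairings and the quadratic equation give
   (a - beta) (W - (a - delta) Z) + z . g <= 0, with both terms nonnegative. *)
have WE : W - (a - delta) * Z = 0 by nra.
have PE : \sum_i z i * degree_defect i = 0 by nra.
split=> i.
  have /eqP := sum_residual; rewrite WE psumr_eq0 => [|j _]; last by rewrite subr_ge0.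
  by move=> /allP /(_ i (mem_index_enum _)); rewrite subr_eq0 => /eqP.
move=> zi; move/eqP: PE; rewrite psumr_eq0; last first.
  by move=> j _; rewrite mulr_ge0 ?degree_defect_ge0.
move=> /allP /(_ i (mem_index_enum _)); rewrite mulf_eq0 gt_eqF //=.
by move=> /eqP.
Qed.
End Upper.

(** * The extremal graphs *)

Lemma nonadjacent_min_degree i : degree_defect i = 0 ->
  forall j, j != i -> ~~ adj G i j -> deg G j = min_degree G.
Proof.
move=> /eqP; rewrite paddr_eq0; first last.
- by rewrite mulr_ge0 ?co_alpha_ge0 // sumr_ge0 // => j _; apply: degree_excess_ge0.
- by rewrite !mulr_ge0 ?degree_excess_ge0 ?degree_gap_ge0.
case/andP => _; rewrite mulf_eq0 subr_eq0 gt_eqF //= psumr_eq0; last first.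
  by move=> j _; apply: degree_excess_ge0.
move=> /allP d0 j ji ij; have := d0 j (mem_index_enum _).
by rewrite ji ij subr_eq0 eqr_nat => /eqP.
Qed.

Lemma degree_defect_eq0 i : deg G i = min_degree G \/ deg G i = max_degree G ->
  (forall j, j != i -> ~~ adj G i j -> deg G j = min_degree G) ->
  degree_defect i = 0.
Proof.
move=> di dj; rewrite /degree_defect big1 => [|j /andP [ji ij]]; last first.
  by rewrite dj ?subrr.
by case: di => ->; rewrite subrr ?(mul0r, mulr0) add0r ?mulr0.
Qed.

(** On S the operator sends 1 to d and d to (bound + s) d - bound s, where s is
    the smaller root; hence d - s is an eigenvector for the larger one.  It is
    nonzero at a vertex of degree Delta because s <= beta < Delta. *)
Lemma bound_eigenvalue (S : {set 'I_n}) :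
  (forall i j, adj G i j -> (i \in S) = (j \in S)) ->
  (forall i, i \in S -> degree_defect i = 0) ->
  (exists2 i, i \in S & deg G i = max_degree G) ->
  eigenvalue (A_alpha alpha G) bound.
Proof.
move=> S_closed S0 [i0 i0S di0]; apply/eigenvalue_A_alphaP.
pose s := delta + beta - bound.
exists (fun i => if i \in S then d i - s else 0).
  (* Delta - beta = (1 - alpha) (Delta + 1) > 0, and s <= beta. *)
  exists i0; rewrite i0S di0 gt_eqF // subr_gt0.
  have [delta_le _] := bound_ge_shifts.
  have : 0 < (1 - alpha) * (Delta + 1) by rewrite mulr_gt0 ?subr_gt0 ?ltr_wpDl.
  rewrite /s; lra.
move=> i; have [iS|iS] := boolP (i \in S); last first.
  rewrite /A_alpha_fun (negPf iS) big1 => [|j ij]; first by rewrite !mulr0 addr0.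
  by rewrite -(S_closed i) // (negPf iS).
transitivity (A_alpha_fun (fun j => d j - delta) i
              + (delta - s) * A_alpha_fun (fun=> 1) i).
  rewrite /A_alpha_fun iS (eq_bigr (fun j => (d j - delta) + (delta - s) * 1)).
    by rewrite big_split -mulr_sumr /=; ring.
  by move=> j ij; rewrite -(S_closed i) // iS; ring.
rewrite A_alpha_fun1 A_alpha_fun_degree_excess S0 // -bound_root /s; ring.
Qed.
End Operator.

Section Extremal.
Variables (n : nat) (G : sgraph n).

(** A vertex j of degree other than delta is adjacent to every other vertex of
    the component, for otherwise it would be a non-neighbour of one of them.
    Therefore j lies in the component and has degree one less than its order.
    Vertices of degree Delta are of this kind when G is not regular. *)
Lemma extremal_component i : ~ is_regular G ->
  (forall k, k \in component G i ->
    forall j, j != k -> ~~ adj G k j -> deg G j = min_degree G) ->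
  [/\ component G i \in components G,
      #|component G i| = (max_degree G).+1,
      (forall x, x \in component G i ->
         deg G x = min_degree G \/ deg G x = max_degree G)
    & forall C' : {set 'I_n}, C' \in components G -> C' != component G i ->
        forall x, x \in C' -> deg G x = min_degree G].
Proof.
move=> nreg nonadj; set C := component G i in nonadj *.
have iC : i \in C by rewrite inE connect0.
have big_deg j : deg G j != min_degree G -> j \in C /\ #|C| = (deg G j).+1.
  move=> dj; have adjC k : k \in C -> k != j -> adj G j k.
    move=> kC kj; rewrite adj_sym; apply: contraNT dj => kNj.
    by apply/eqP/(nonadj k); rewrite // eq_sym.
  have jC : j \in C.
    by have [<-//|ij] := eqVneq i j; rewrite inE connect1 // adj_sym adjC.
  split=> //; apply/eqP; rewrite eqn_leq; apply/andP; split; last first.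
    by have := deg_lt_component G j; rewrite (component_eq jC).
  rewrite (cardsD1 j) jC add1n ltnS subset_leq_card //.
  by apply/fintype.subsetP => k; rewrite in_setD1 inE => /andP [kj kC]; apply: adjC.
have n_gt0 : (0 < n)%N by case: (n) i {C nonadj iC big_deg} => [[]|].
have [w dw] := max_degree_ex G n_gt0.
have cardC : #|C| = (max_degree G).+1.
  have [wmin|/big_deg [_ ->]] := eqVneq (deg G w) (min_degree G); last by rewrite dw.
  case: nreg; exists (min_degree G) => x; apply/eqP.
  by rewrite eqn_leq min_le_deg -{1}wmin dw deg_le_max.
split=> //.
- by rewrite inE; apply/existsP; exists i.
- move=> x _; have [|/big_deg [_]] := eqVneq (deg G x) (min_degree G); first by left.
  by rewrite cardC => -[->]; right.
move=> C'; rewrite inE => /existsP [u /eqP ->] neC x xu.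
apply/eqP; apply: contraNT neC => /big_deg [xC _].
by rewrite -(component_eq xu) (component_eq xC).
Qed.

End Extremal.

Theorem theorem1p9 (R : realType) (n : nat) (G : sgraph n) (alpha : R)
    (n_gt0 : (0 < n)%N) (alpha_ge0 : 0 <= alpha) (alpha_lt1 : alpha < 1) :
  rho_alpha alpha G <= Num.min (max_degree G)%:R (degree_size_bound alpha G) /\
  (rho_alpha alpha G = degree_size_bound alpha G <->
   is_regular G \/
   exists C : {set 'I_n},
     [/\ C \in components G,
         #|C| = (max_degree G).+1,
         (forall x, x \in C -> deg G x = min_degree G \/ deg G x = max_degree G)
       & forall C' : {set 'I_n}, C' \in components G -> C' != C ->
           forall x, x \in C' -> deg G x = min_degree G]).
Proof.
have [eig eig_max] := largest_eigenvalueP n_gt0 (A_alpha_sym alpha G).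
rewrite -/(rho_alpha alpha G) in eig eig_max.
have [x [i0 xi0] xA] := (eigenvalue_A_alphaP G alpha _).1 eig.
pose z i := `|x i|.
have z_ge0 i : 0 <= z i by apply: normr_ge0.
have z_gt0 : exists i, 0 < z i by exists i0; rewrite normr_gt0.
have zA i : rho_alpha alpha G * z i <= A_alpha_fun G alpha z i.
  exact: A_alpha_fun_norm.
have rho_le : rho_alpha alpha G <= degree_size_bound alpha G.
  exact: (subeigenvalue_le_bound alpha_ge0 alpha_lt1 z_ge0 z_gt0 zA).
split; first by rewrite le_min rho_le (subeigenvalue_le_max_degree z_ge0 z_gt0 zA).
split=> [rhoE|extremal].
  have [|nreg] := boolp.EM (is_regular G); [by left|right].
  have [zAE defect0] :=
    subeigenvalue_eq_bound alpha_ge0 alpha_lt1 z_ge0 z_gt0 zA rhoE nreg.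
  have [i zi] := z_gt0; exists (component G i); apply: extremal_component => //.
  move=> k; rewrite inE => ik; apply: (nonadjacent_min_degree alpha_ge0 alpha_lt1).
  by apply: defect0; apply: (A_alpha_fun_supp alpha_lt1 z_ge0 zAE ik).
apply/eqP; rewrite eq_le rho_le; apply: eig_max.
have [w dw] := max_degree_ex G n_gt0.
case: extremal => [[k dk]|[C [/[dup] CG /[!inE] /existsP [u /eqP CE] cardC dC dC']]].
  have dmin := min_degree_regular n_gt0 dk.
  apply: (bound_eigenvalue alpha_lt1 (S := [set: 'I_n])).
  - by move=> i j _; rewrite !inE.
  - by move=> i _; apply: degree_defect_eq0 => [|j _ _]; [left|]; rewrite dk.
  by exists w; rewrite ?inE.
have out y : y \notin C -> deg G y = min_degree G.
  move=> yC; apply: (dC' (component G y)); last by rewrite inE connect0.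
    by rewrite inE; apply/existsP; exists y.
  by apply: contraNneq yC => <-; rewrite inE connect0.
have full j k : j \in C -> k \in C -> deg G j = max_degree G -> k != j -> adj G j k.
  rewrite CE => jC kC dj; apply: adj_of_deg_component; rewrite (component_eq jC) //.
  by rewrite dj -CE.
apply: (bound_eigenvalue alpha_lt1 (S := C)).
- move=> i j ij; rewrite CE !inE.
  by apply: same_connect1r => //; apply: sym_connect_sym (adj_sym G).
- move=> i iC; apply: degree_defect_eq0 => [|j ji ij]; first exact: dC.
  have [jC|] := boolP (j \in C); last exact: out.
  case: (dC j jC) => // dj; case/negP: ij.
  by rewrite adj_sym full // eq_sym.
(* If Delta is attained only outside C, then Delta = delta and any vertex of C
   serves. *)
have [wC|wC] := boolP (w \in C); first by exists w.
have uC : u \in C by rewrite CE inE connect0.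
by exists u => //; case: (dC u uC) => // ->; rewrite -dw out.
Qed.
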